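(* Suppose the skew parameter of the content popularity is $\delta=1$, so that caching the $N_c$ most popular of $N_f$ contents gives cache hit ratio $p_h(N_c)=\big(\sum_{f=1}^{N_c} f^{-1}\big)\big/\big(\sum_{j=1}^{N_f} j^{-1}\big)$, and let $EE(N_c)$, $N_c\in\{0,1,\dots,N_f\}$, be the network energy efficiency $$EE(N_c)=\frac{p_a\big(p_h(N_c)\bar R_{\rm ca}+(1-p_h(N_c))\bar R_{\rm bh}\big)}{p_aP_a+(1-p_a)P_i+w_{\rm ca}N_cF+p_aw_{\rm bh}(1-p_h(N_c))\bar R_{\rm bh}}.$$ If $$w_{\rm ca}F\sum_{j=1}^{N_f}j^{-1}<\Big(\frac{\bar R_{\rm ca}}{\bar R_{\rm bh}}-1\Big)\big(p_aP_a+(1-p_a)P_i\big)+p_aw_{\rm bh}\bar R_{\rm ca},$$ then caching improves the energy efficiency, i.e. there is $N_c\in\{1,\dots,N_f\}$ with $EE(N_c)>EE(0)$. Otherwise caching cannot improve it, i.e. $EE(N_c)\le EE(0)$ for every $N_c\in\{1,\dots,N_f\}$.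
   Context: Model: a downlink network of base stations (BSs), each serving at most one user at a time and each caching the $N_c$ most popular contents from a catalog of $N_f\ge 1$ contents, each of size $F>0$. $p_a\in(0,1)$ is the probability that a BS is active; $P_a>0$, $P_i>0$ are the transmit-plus-circuit powers of a BS in active and idle mode; $w_{\rm ca}>0$ and $w_{\rm bh}>0$ are the power coefficients of cache and backhaul hardware. $\bar R_{\rm ca}$ and $\bar R_{\rm bh}$ are the (approximated) average rates of a user whose content is, respectively is not, cached at its BS: $$\bar R_{\rm ca}=\frac{\alpha B}{2\ln 2}+\bar R_{\rm e},\qquad \bar R_{\rm bh}=\begin{cases}C_{\rm bh},& C_{\rm bh}\le \bar R_{\rm e},\\ \bar R_{\rm ca}-\frac{\alpha B}{2\ln2}\,2^{-\frac{2(C_{\rm bh}-\bar R_{\rm e})}{\alpha B}},&\text{otherwise,}\end{cases}$$ where $B>0$ is the bandwidth, $\alpha>2$ the path-loss exponent, $C_{\rm bh}>0$ the backhaul capacity, and $\bar R_{\rm e}$ (a real number not depending on $N_c$) the average rate of a cell-edge user under unlimited backhaul. The rate $\bar R_{\rm bh}$ is assumed positive. Note that $p_h(0)=0$. *)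

(* Defs.v *)
From mathcomp Require Import all_boot all_order all_algebra.
From mathcomp Require Import all_classical all_reals all_analysis.

Set Implicit Arguments.
Unset Strict Implicit.
Unset Printing Implicit Defensive.

Import Order.TTheory GRing.Theory Num.Theory.
Local Open Scope ring_scope.

Definition harmonic_sum (R : realType) (n : nat) : R :=
  \sum_(1 <= f < n.+1) f%:R^-1.

(* Zipf popularity with skew parameter 1: content f is requested with
   probability f^-1 / \sum_(1 <= j <= Nf) j^-1. *)
Definition cache_hit_ratio (R : realType) (Nf Nc : nat) : R :=
  harmonic_sum R Nc / harmonic_sum R Nf.

Definition rate_cached (R : realType) (alpha B Re : R) : R :=
  alpha * B / (2 * ln 2) + Re.

Definition rate_backhaul (R : realType) (alpha B Cbh Re : R) : R :=
  if Cbh <= Re then Cbh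
  else rate_cached alpha B Re
       - alpha * B / (2 * ln 2) * 2 `^ (- (2 * (Cbh - Re) / (alpha * B))).

Definition energy_efficiency (R : realType)
    (pa Pa Pi wca wbh F Rca Rbh : R) (Nf Nc : nat) : R :=
  let ph := cache_hit_ratio R Nf Nc in
  pa * (ph * Rca + (1 - ph) * Rbh)
  / (pa * Pa + (1 - pa) * Pi + wca * Nc%:R * F
     + pa * wbh * (1 - ph) * Rbh).

(* Main.v *)
(* With P0 = pa Pa + (1 - pa) Pi and X = (Rca/Rbh - 1) P0 + pa wbh Rca, clearing
   denominators turns EE Nc > EE 0 into
     wca F Nc H(Nf) < H(Nc) X,   H(n) = 1 + 1/2 + ... + 1/n.
   At Nc = 1 this is exactly the caching condition; since H(Nc) <= Nc, it
   fails for every Nc >= 1 as soon as it fails at Nc = 1. *)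
Require Import Defs.
From mathcomp Require Import all_boot all_order all_algebra.
From mathcomp Require Import all_classical all_reals all_analysis.
From mathcomp Require Import ring.

Set Implicit Arguments.
Unset Strict Implicit.
Unset Printing Implicit Defensive.

Import Order.TTheory GRing.Theory Num.Theory.
Local Open Scope ring_scope.

Lemma harmonic_sum0 (R : realType) : harmonic_sum R 0 = 0.
Proof. by rewrite /harmonic_sum big_geq. Qed.

Lemma harmonic_sumS (R : realType) n :
  harmonic_sum R n.+1 = harmonic_sum R n + n.+1%:R^-1.
Proof. by rewrite /harmonic_sum big_nat_recr. Qed.

Lemma harmonic_sum1 (R : realType) : harmonic_sum R 1 = 1.
Proof. by rewrite harmonic_sumS harmonic_sum0 add0r invr1. Qed.

Lemma harmonic_sum_homo (R : realType) :
  {homo @harmonic_sum R : m n / (m <= n)%N >-> m <= n}.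
Proof.
apply: homo_leq => [n|n m p|n]; [exact: lexx|exact: le_trans|].
by rewrite harmonic_sumS lerDl invr_ge0.
Qed.

Lemma harmonic_sum_gt0 (R : realType) n :
  (0 < n)%N -> 0 < harmonic_sum R n.
Proof.
move=> n_gt0; apply: (lt_le_trans ltr01).
by rewrite -(harmonic_sum1 R); apply: harmonic_sum_homo.
Qed.

(** Every term is at most 1, its value at the first content: no cache size yields more hit ratio per
    cached content than [Nc = 1]. *)
Lemma harmonic_sum_le (R : realType) n : harmonic_sum R n <= n%:R.
Proof.
elim: n => [|n IHn]; first by rewrite harmonic_sum0.
rewrite harmonic_sumS -[in leRHS]natr1 lerD //.
by rewrite invf_le1 ?ltr0Sn // ler1n.
Qed.

(** As an equality of booleans, one computation serves both halves of the theorem: directly for a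
    gain, negated for [EE Nc <= EE 0]. *)
Lemma energy_efficiency_lt (R : realType)
    (pa Pa Pi wca wbh F Rca Rbh : R) (Nf Nc : nat) :
  let P0 := pa * Pa + (1 - pa) * Pi in
  let EE := energy_efficiency pa Pa Pi wca wbh F Rca Rbh Nf in
  (0 < Nf)%N -> (Nc <= Nf)%N -> 0 < pa -> 0 < P0 -> 0 <= wca * F ->
  0 <= wbh -> 0 < Rbh ->
  (EE 0%N < EE Nc) =
  (wca * F * Nc%:R * harmonic_sum R Nf
    < harmonic_sum R Nc * ((Rca / Rbh - 1) * P0 + pa * wbh * Rca)).
Proof.
move=> P0 EE Nf_gt0 leNcf pa_gt0 P0_gt0 wF_ge0 wbh_ge0 Rbh_gt0.
rewrite /EE /energy_efficiency /cache_hit_ratio harmonic_sum0 -/P0.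
have H_gt0 := harmonic_sum_gt0 R Nf_gt0.
have leH := harmonic_sum_homo R leNcf.
set H := harmonic_sum R Nf in H_gt0 leH *; set h := harmonic_sum R Nc in leH *.
(* A nonnegative miss ratio, from [Nc <= Nf], keeps the backhaul power nonnegative and so the
   denominator at [Nc] positive. *)
have miss_ge0 : 0 <= 1 - h / H by rewrite subr_ge0 ler_pdivrMr // mul1r.
have den0_gt0 : 0 < P0 + wca * 0%:R * F + pa * wbh * (1 - 0 / H) * Rbh.
  by rewrite mulr0 !mul0r addr0 subr0 ltr_wpDr // !mulr_ge0 // ltW.
have den_gt0 : 0 < P0 + wca * Nc%:R * F + pa * wbh * (1 - h / H) * Rbh.
  rewrite ltr_wpDr //; first by rewrite !mulr_ge0 // ltW.
  by rewrite ltr_wpDr // mulrAC mulr_ge0.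
rewrite ltr_pdivrMr // [ltRHS]mulrAC ltr_pdivlMr //.
rewrite -subr_gt0 -[RHS]subr_gt0.
(* In the cross-multiplied difference the [h / H * pa * wbh * Rbh ^ 2] terms cancel; what remains
   has the common factor [pa * Rbh / H], whose positive inverse appears here. *)
have -> : h * ((Rca / Rbh - 1) * P0 + pa * wbh * Rca) - wca * F * Nc%:R * H =
    H / (pa * Rbh) *
    (pa * (h / H * Rca + (1 - h / H) * Rbh) *
       (P0 + wca * 0%:R * F + pa * wbh * (1 - 0 / H) * Rbh) -
     pa * (0 / H * Rca + (1 - 0 / H) * Rbh) *
       (P0 + wca * Nc%:R * F + pa * wbh * (1 - h / H) * Rbh)).
  by field; rewrite !gt_eqF.
by rewrite [RHS]pmulr_rgt0 // divr_gt0 // mulr_gt0.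
Qed.

Theorem proposition1 (R : realType)
    (pa Pa Pi wca wbh F alpha B Cbh Re : R) (Nf : nat)
    (hNf : (1 <= Nf)%N) (hF : 0 < F)
    (hpa0 : 0 < pa) (hpa1 : pa < 1)
    (hPa : 0 < Pa) (hPi : 0 < Pi)
    (hwca : 0 < wca) (hwbh : 0 < wbh)
    (hB : 0 < B) (halpha : 2 < alpha) (hCbh : 0 < Cbh)
    (hRbh : 0 < rate_backhaul alpha B Cbh Re) :
  let Rca := rate_cached alpha B Re in
  let Rbh := rate_backhaul alpha B Cbh Re in
  let EE := energy_efficiency pa Pa Pi wca wbh F Rca Rbh Nf in
  let caching_condition :=
    wca * F * harmonic_sum R Nf
      < (Rca / Rbh - 1) * (pa * Pa + (1 - pa) * Pi) + pa * wbh * Rca in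
  (caching_condition ->
     exists Nc : nat, (1 <= Nc <= Nf)%N /\ EE 0%N < EE Nc) /\
  (~~ caching_condition ->
     forall Nc : nat, (1 <= Nc <= Nf)%N -> EE Nc <= EE 0%N).
Proof.
move=> Rca Rbh EE cond.
have P0_gt0 : 0 < pa * Pa + (1 - pa) * Pi.
  by rewrite addr_gt0 // mulr_gt0 // subr_gt0.
have wF_ge0 : 0 <= wca * F by rewrite mulr_ge0 // ltW.
have EE_lt Nc (leNcf : (Nc <= Nf)%N) := energy_efficiency_lt
  Rca hNf leNcf hpa0 P0_gt0 wF_ge0 (ltW hwbh) hRbh.
split=> [condT|condF Nc /andP[_ leNcf]].
  by exists 1%N; rewrite hNf EE_lt // harmonic_sum1 mulr1 mul1r.
rewrite leNgt EE_lt // -leNgt.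
move: condF; rewrite /cond -leNgt => leX.
have h_ge0 : 0 <= harmonic_sum R Nc.
  by rewrite -(harmonic_sum0 R); apply: harmonic_sum_homo.
(* With [h], [H] the sums up to [Nc], [Nf] and [X] the right side of [cond], the chain is [h * X <=
   h * (wca * F * H) <= wca * F * Nc * H]; the second step uses [h <= Nc]. *)
apply: le_trans (ler_wpM2l h_ge0 leX) _.
rewrite [leLHS]mulrC [leLHS]mulrAC ler_wpM2r ?(ltW (harmonic_sum_gt0 R hNf)) //.
by rewrite ler_wpM2l // harmonic_sum_le.
Qed.
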